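(* The first Gelfand-Fuks cohomology group of $\mathrm{Vect}(S^1)$ with values in $\mathbb{R}$ is trivial: $$H^1_{GF}(\mathrm{Vect}(S^1);\mathbb{R})=\{0\}.$$
   Context: $\mathrm{Vect}(S^1)\cong C^\infty(S^1)$ (smooth real $2\pi$-periodic functions) is the Lie algebra with bracket $[u,v]=uv_x-u_xv$. A $p$-cochain (alternating $p$-linear map $\gamma:\mathrm{Vect}(S^1)^p\to\mathbb{R}$) is called local if $\gamma(u_1,\dots,u_p)=\int_{S^1}P(u_1,\dots,u_p)\,dx$ for some $p$-linear differential operator $P$ with smooth coefficients; $0$-cochains are real constants. The coboundary operator is $$\partial\gamma(u_0,\dots,u_p)=\sum_{i<j}(-1)^{i+j}\gamma([u_i,u_j],u_0,\dots,\widehat{u_i},\dots,\widehat{u_j},\dots,u_p),$$ so $\partial=0$ on $0$-cochains and $\partial\gamma(u,v)=-\gamma([u,v])$ for $1$-cochains. It maps local cochains to local cochains and $\partial\circ\partial=0$. The Gelfand-Fuks cohomology $H^p_{GF}(\mathrm{Vect}(S^1);\mathbb{R})$ is the cohomology of the complex of local cochains: local $p$-cochains $\gamma$ with $\partial\gamma=0$ modulo those of the form $\partial\mu$ with $\mu$ a local $(p-1)$-cochain. *)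

(* Defs.v *)
From HB Require Import structures.
From mathcomp Require Import all_boot all_order all_algebra.
From mathcomp Require Import generic_quotient ring_quotient.
From mathcomp Require Import all_classical all_reals all_analysis.

Set Implicit Arguments.
Unset Strict Implicit.
Unset Printing Implicit Defensive.

Import Order.TTheory GRing.Theory Num.Theory.
Import numFieldNormedType.Exports.

Local Open Scope ring_scope.
Local Open Scope classical_set_scope.

(* In ring_scope these would be derivatives of polynomials. *)
Local Notation "f ^` ()" := (derive1 f) : ring_scope.
Local Notation "f ^` ( n )" := (derive1n n f) : ring_scope.

Definition smooth (R : realType) (f : R -> R) : Prop :=
  forall n x, derivable (f^`(n)) x 1.

Section SmoothTheory.
Context (R : realType).
Implicit Types f g : R -> R.

Lemma smooth_derivable f : smooth f -> forall x, derivable f x 1.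
Proof. by move=> sf x; exact: (sf 0%N x). Qed.

Lemma smooth_derive1 f : smooth f -> smooth f^`().
Proof. by move=> sf n x; have := sf n.+1 x; rewrite /derive1n iterSr. Qed.

Lemma smooth_derive1n f n : smooth f -> smooth f^`(n).
Proof.
by move=> sf; elim: n => [//|n IHn]; rewrite derive1nS; exact: smooth_derive1.
Qed.

Lemma smooth_continuous f : smooth f -> continuous f.
Proof.
move=> sf x; apply: differentiable_continuous; apply/derivable1_diffP.
exact: smooth_derivable.
Qed.

Lemma derive1n_cst (c : R) n : (cst c)^`(n.+1) = cst 0.
Proof.
elim: n => [|n IHn]; last rewrite derive1nS IHn;
  by apply/funext => x; rewrite ?derive1n1 derive1_cst.
Qed.

Lemma smooth_cst (c : R) : smooth (cst c).
Proof. by case=> [|n] x; rewrite ?derive1n_cst; exact: derivable_cst. Qed.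

Lemma derive1nD f g n : smooth f -> smooth g ->
  (f + g)^`(n) = f^`(n) + g^`(n).
Proof.
move=> sf sg; elim: n => [//|n IHn]; rewrite !derive1nS IHn.
by apply/funext => x; rewrite derive1E deriveD ?fctE ?derive1E//.
Qed.

Lemma derive1nZ (c : R) f n : smooth f -> (c *: f)^`(n) = c *: f^`(n).
Proof.
move=> sf; elim: n => [//|n IHn]; rewrite !derive1nS IHn.
by apply/funext => x; rewrite derive1E deriveZ ?fctE ?derive1E//.
Qed.

Lemma smoothD f g : smooth f -> smooth g -> smooth (f + g).
Proof. by move=> sf sg n x; rewrite derive1nD//; exact: derivableD. Qed.

Lemma smoothZ (c : R) f : smooth f -> smooth (c *: f).
Proof. by move=> sf n x; rewrite derive1nZ//; exact: derivableZ. Qed.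

Lemma smoothN f : smooth f -> smooth (- f).
Proof. by move=> sf; rewrite -scaleN1r; exact: smoothZ. Qed.

Lemma smoothB f g : smooth f -> smooth g -> smooth (f - g).
Proof. by move=> sf sg; apply: smoothD => //; exact: smoothN. Qed.

Let derivable_upto n f := forall j x, (j <= n)%N -> derivable (f^`(j)) x 1.

Let derivable_uptoS n f : derivable_upto n.+1 f <->
  (forall x, derivable f x 1) /\ derivable_upto n f^`().
Proof.
split=> [Hf|[df Hf] [|j] x jn]; last 2 first.
- exact: df.
- by rewrite /derive1n iterSr; exact: Hf.
split=> [x|j x jn]; first exact: (Hf 0%N).
by have := Hf j.+1 x jn; rewrite /derive1n iterSr.
Qed.

Let derivable_uptoW n f : derivable_upto n.+1 f -> derivable_upto n f.
Proof. by move=> Hf j x jn; apply: Hf; exact: leqW. Qed.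

Let derivable_uptoD n f g :
  derivable_upto n f -> derivable_upto n g -> derivable_upto n (f + g).
Proof.
elim: n f g => [|n IHn] f g Hf Hg.
  move=> [|//] x _; apply: derivableD; [exact: (Hf 0%N)|exact: (Hg 0%N)].
move: Hf Hg => /derivable_uptoS[df Hf] /derivable_uptoS[dg Hg].
apply/derivable_uptoS; split=> [x|]; first exact: derivableD.
rewrite (_ : (f + g)^`() = f^`() + g^`()); first exact: IHn.
by apply/funext => x; rewrite derive1E deriveD ?fctE ?derive1E.
Qed.

Let derivable_uptoM n f g :
  derivable_upto n f -> derivable_upto n g -> derivable_upto n (f * g).
Proof.
elim: n f g => [|n IHn] f g Hf Hg.
  move=> [|//] x _; apply: derivableM; [exact: (Hf 0%N)|exact: (Hg 0%N)].
have [Wf Wg] := (derivable_uptoW Hf, derivable_uptoW Hg).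
move: Hf Hg => /derivable_uptoS[df Hf] /derivable_uptoS[dg Hg].
apply/derivable_uptoS; split=> [x|]; first exact: derivableM.
rewrite (_ : (f * g)^`() = f * g^`() + g * f^`()).
  by apply: derivable_uptoD; exact: IHn.
by apply/funext => x; rewrite derive1E deriveM ?fctE ?derive1E.
Qed.

Lemma smoothM f g : smooth f -> smooth g -> smooth (f * g).
Proof.
by move=> sf sg n x; exact: (@derivable_uptoM n f g).
Qed.

Lemma periodic_derive1n f (T : R) n : periodic f T -> periodic f^`(n) T.
Proof.
move=> pf; elim: n => [//|n pfn] x; rewrite derive1nS /derive1.
suff -> : (fun h => h^-1 *: (f^`(n) (h + (x + T)) - f^`(n) (x + T))) =
          (fun h => h^-1 *: (f^`(n) (h + x) - f^`(n) x)) by [].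
by apply/funext => h; rewrite addrA !pfn.
Qed.

End SmoothTheory.

Definition is_vect (R : realType) : {pred (R -> R)} :=
  fun f => `[< smooth f /\ periodic f (pi *+ 2) >].

(* The vector field u(x) d/dx on the circle R / 2 pi Z is represented by the
   function u. *)
Record Vect (R : realType) := MkVect {
  vect_fun :> R -> R ;
  _ : vect_fun \in @is_vect R
}.

HB.instance Definition _ (R : realType) := [isSub for @vect_fun R].
HB.instance Definition _ (R : realType) := [Choice of Vect R by <:].

Section VectTheory.
Context (R : realType).

Fact is_vect_submod_closed : submod_closed (@is_vect R).
Proof.
split; first by apply/asboolP; split=> //; exact: smooth_cst.
move=> a f g /asboolP[sf pf] /asboolP[sg pg]; apply/asboolP; split.
  by apply: smoothD => //; exact: smoothZ.
by move=> x; rewrite !fctE pf pg.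
Qed.

HB.instance Definition _ :=
  GRing.isSubmodClosed.Build R (R -> R) (@is_vect R) is_vect_submod_closed.
HB.instance Definition _ := [SubChoice_isSubLmodule of Vect R by <:].

Lemma vect_smooth (u : Vect R) : smooth u.
Proof. by have /asboolP[] := valP u. Qed.

Lemma vect_periodic (u : Vect R) : periodic u (pi *+ 2).
Proof. by have /asboolP[] := valP u. Qed.

Fact bracket_is_vect (u v : Vect R) :
  (fun x => u x * v^`() x - u^`() x * v x) \in @is_vect R.
Proof.
have [su sv] := (@vect_smooth u, @vect_smooth v).
apply/asboolP; split.
  rewrite -[X in smooth X]/((u : R -> R) * v^`() - u^`() * (v : R -> R)).
  by apply: smoothB; apply: smoothM => //; exact: smooth_derive1.
by move=> x; rewrite -!derive1n1 !(periodic_derive1n _ (@vect_periodic _))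
  !vect_periodic.
Qed.

Definition bracket (u v : Vect R) : Vect R := MkVect (bracket_is_vect u v).

End VectTheory.

Section Cochains.
Context (R : realType).

(* For p = 0 the only argument is the empty family, so that a function
   ('I_0 -> Vect R) -> R is a real constant. *)
Definition multilinear p (g : ('I_p -> Vect R) -> R) : Prop :=
  forall (i : 'I_p) (u : 'I_p -> Vect R) (a : R) (v w : Vect R),
    g (dfwith u i (a *: v + w)) = a * g (dfwith u i v) + g (dfwith u i w).

Definition alternating p (g : ('I_p -> Vect R) -> R) : Prop :=
  forall (u : 'I_p -> Vect R) (i j : 'I_p), i != j -> u i = u j -> g u = 0.

Definition is_cochain p (g : ('I_p -> Vect R) -> R) : Prop :=
  multilinear g /\ alternating g.

(* A p-linear differential operator with smooth coefficients on the circle: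
   a finite sum of terms (u_1, ..., u_p) |-> a u_1^(k_1) ... u_p^(k_p), each of
   them listed as the pair (a, k). *)
Definition is_diffop p (P : ('I_p -> Vect R) -> R -> R) : Prop :=
  exists s : seq (Vect R * ('I_p -> nat)),
    forall u x, P u x = \sum_(m <- s) m.1 x * \prod_(i < p) (u i)^`(m.2 i) x.

Definition local p (g : ('I_p -> Vect R) -> R) : Prop :=
  exists2 P, is_diffop P &
    forall u, g u = \int[lebesgue_measure]_(x in `[0, pi *+ 2]) P u x.

Definition is_local_cochain p (g : ('I_p -> Vect R) -> R) : Prop :=
  is_cochain g /\ local g.

(* The family ([u_i, u_j], u_0, ..., u_p) with u_i and u_j omitted from the
   tail; for i != j the list below has p elements. *)
Definition contract p (u : 'I_p.+1 -> Vect R) (i j : 'I_p.+1) :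
    'I_p -> Vect R :=
  fun k => nth 0 (bracket (u i) (u j) ::
    [seq u l | l <- enum 'I_p.+1 & (l != i) && (l != j)]) k.

Definition coboundary p (g : ('I_p -> Vect R) -> R) :
    ('I_p.+1 -> Vect R) -> R :=
  fun u => \sum_(i < p.+1) \sum_(j < p.+1 | (i < j)%N)
    (-1) ^+ (i + j) * g (contract u i j).

Definition is_cocycle p : {pred (('I_p -> Vect R) -> R)} :=
  fun g => `[< is_local_cochain g /\ coboundary g = 0 >].

Definition is_coboundary p : (('I_p -> Vect R) -> R) -> Prop :=
  match p with
  | 0 => fun g => g = 0
  | q.+1 => fun g => exists2 m : ('I_q -> Vect R) -> R,
      is_local_cochain m & g = coboundary m
  end.

End Cochains.

Section CochainTheory.
Context (R : realType).
Implicit Type p : nat.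

Lemma is_cochainB p (g h : ('I_p -> Vect R) -> R) :
  is_cochain g -> is_cochain h -> is_cochain (g - h).
Proof.
move=> [Mg Ag] [Mh Ah]; split=> [i u a v w|u i j ij uij]; rewrite !fctE.
  by rewrite Mg Mh opprD addrACA mulrBr.
by rewrite (Ag _ _ _ ij uij) (Ah _ _ _ ij uij) subrr.
Qed.

Lemma is_cochain0 p : is_cochain (0 : ('I_p -> Vect R) -> R).
Proof. by split=> [i u a v w|//]; rewrite mulr0 addr0. Qed.

Lemma diffop_smooth p (P : ('I_p -> Vect R) -> R -> R) u :
  is_diffop P -> smooth (P u).
Proof.
move=> [s /(_ u)/funext ->].
elim: s => [|m s IHs].
  rewrite (_ : (fun _ => _) = cst 0); first exact: smooth_cst.
  by apply/funext => x; rewrite big_nil.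
rewrite (_ : (fun _ => _) =
  (m.1 : R -> R) * (fun x => \prod_(i < p) (u i)^`(m.2 i) x) +
  (fun x => \sum_(m <- s) m.1 x * \prod_(i < p) (u i)^`(m.2 i) x)); last first.
  by apply/funext => x; rewrite big_cons.
apply: smoothD => //; apply: smoothM; first exact: vect_smooth.
elim: (index_enum _) => [|i r IHr].
  rewrite (_ : (fun _ => _) = cst 1); first exact: smooth_cst.
  by apply/funext => x; rewrite big_nil.
rewrite (_ : (fun _ => _) = (u i)^`(m.2 i) *
  (fun x => \prod_(i <- r) (u i)^`(m.2 i) x)); last first.
  by apply/funext => x; rewrite big_cons.
apply: smoothM => //; apply: smooth_derive1n; exact: vect_smooth.
Qed.

Lemma smooth_integrable (f : R -> R) (a b : R) : smooth f ->
  lebesgue_measure.-integrable `[a, b] (EFin \o f).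
Proof.
move=> sf; apply: continuous_compact_integrable; first exact: segment_compact.
by apply: continuous_subspaceT; exact: smooth_continuous.
Qed.

Lemma is_diffopB p (P Q : ('I_p -> Vect R) -> R -> R) :
  is_diffop P -> is_diffop Q -> is_diffop (fun u x => P u x - Q u x).
Proof.
move=> [s Ps] [t Qt]; exists (s ++ [seq (- m.1, m.2) | m <- t]) => u x.
rewrite big_cat big_map Ps Qt/= -sumrN; congr +%R.
by apply: eq_bigr => m _; rewrite -mulNr.
Qed.

Lemma localB p (g h : ('I_p -> Vect R) -> R) :
  local g -> local h -> local (g - h).
Proof.
move=> [P dP gP] [Q dQ hQ]; exists (fun u x => P u x - Q u x).
  exact: is_diffopB.
move=> u; rewrite RintegralB ?fctE ?gP ?hQ//;
  by apply: smooth_integrable; exact: diffop_smooth.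
Qed.

Lemma local0 p : local (0 : ('I_p -> Vect R) -> R).
Proof.
exists (fun _ _ => 0) => [|u]; first by exists [::] => u x; rewrite big_nil.
by rewrite /Rintegral integral0.
Qed.

Lemma is_local_cochainB p (g h : ('I_p -> Vect R) -> R) :
  is_local_cochain g -> is_local_cochain h -> is_local_cochain (g - h).
Proof.
by move=> [? ?] [? ?]; split; [exact: is_cochainB|exact: localB].
Qed.

Lemma is_local_cochain0 p : is_local_cochain (0 : ('I_p -> Vect R) -> R).
Proof. by split; [exact: is_cochain0|exact: local0]. Qed.

Lemma coboundaryB p (g h : ('I_p -> Vect R) -> R) :
  coboundary (g - h) = coboundary g - coboundary h.
Proof.
apply/funext => u; rewrite !fctE /coboundary -sumrB; apply: eq_bigr => i _.
by rewrite -sumrB; apply: eq_bigr => j _; rewrite mulrBr.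
Qed.

Lemma coboundary0 p : coboundary (0 : ('I_p -> Vect R) -> R) = 0.
Proof. by rewrite -[X in coboundary X](subrr 0) coboundaryB subrr. Qed.

Lemma coboundary_0cochain (g : ('I_0 -> Vect R) -> R) : coboundary g = 0.
Proof.
apply/funext => u; rewrite /coboundary big1// => i _.
by rewrite big1// => j; rewrite !ord1.
Qed.

Lemma coboundary_1cochain (g : ('I_1 -> Vect R) -> R) (u : 'I_2 -> Vect R) :
  coboundary g u = - g (fun=> bracket (u ord0) (u ord_max)).
Proof.
have E1 : lift ord0 ord0 = ord_max :> 'I_2 by exact/val_inj.
have C : contract u ord0 ord_max = fun=> bracket (u ord0) (u ord_max).
  by apply/funext => k; rewrite /contract ord1.
rewrite /coboundary big_ord_recl big_ord1 !E1.
rewrite big_mkcond big_ord_recl big_ord1 !E1/=.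
by rewrite big_mkcond big_ord_recl big_ord1 !E1/= C expr1 mulN1r !addr0 add0r.
Qed.

Fact is_cocycle_zmod_closed p : zmod_closed (@is_cocycle R p).
Proof.
split.
  by apply/asboolP; split; [exact: is_local_cochain0|exact: coboundary0].
move=> g h /asboolP[lg cg] /asboolP[lh ch]; apply/asboolP.
by split; [exact: is_local_cochainB|rewrite coboundaryB cg ch subrr].
Qed.

HB.instance Definition _ p := GRing.isZmodClosed.Build
  (('I_p -> Vect R) -> R) (@is_cocycle R p) (@is_cocycle_zmod_closed p).

End CochainTheory.

Record cocycle (R : realType) (p : nat) := MkCocycle {
  cocycle_fun :> ('I_p -> Vect R) -> R ;
  _ : cocycle_fun \in @is_cocycle R p
}.

HB.instance Definition _ (R : realType) p := [isSub for @cocycle_fun R p].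
HB.instance Definition _ (R : realType) p := [Choice of cocycle R p by <:].
HB.instance Definition _ (R : realType) p :=
  [SubChoice_isSubZmodule of cocycle R p by <:].

Definition coboundaries (R : realType) p : {pred cocycle R p} :=
  fun z => `[< is_coboundary (z : ('I_p -> Vect R) -> R) >].

Fact coboundaries_zmod_closed (R : realType) p :
  zmod_closed (@coboundaries R p).
Proof.
split=> [|y z]; first apply/asboolP.
  case: p => [//|q]; exists 0; first exact: is_local_cochain0.
  by rewrite coboundary0.
move=> /asboolP By /asboolP Bz; apply/asboolP.
case: p y z By Bz => [|q] y z /=; first by move=> y0 z0; rewrite y0 z0 subrr.
move=> [m lm ->] [n ln ->]; exists (m - n); first exact: is_local_cochainB.
by rewrite coboundaryB.
Qed.

HB.instance Definition _ (R : realType) p := GRing.isZmodClosed.Build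
  (cocycle R p) (@coboundaries R p) (@coboundaries_zmod_closed R p).

(* The quotient is taken as an additive group: the scalar action it inherits
   plays no role in its vanishing. *)
Definition H_GF (R : realType) (p : nat) : zmodType :=
  Quotient.quot (@coboundaries R p).

(* Main.v *)
(* Locality plays no role: the Lie algebra Vect(S^1) is perfect, so a 1-cochain
   that vanishes on all brackets vanishes. Subtracting from w its mean value c
   leaves a function with a periodic antiderivative v, that is
   w = [1, v] + c, and the constant c is the bracket [- c sin, cos]. *)
Require Import Defs.
From mathcomp Require Import all_boot all_order all_algebra.
From mathcomp Require Import generic_quotient ring_quotient ring.
From mathcomp Require Import all_classical all_reals all_analysis.

Set Implicit Arguments.
Unset Strict Implicit.
Unset Printing Implicit Defensive.

Import Order.TTheory GRing.Theory Num.Theory.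
Import numFieldNormedType.Exports.

Local Open Scope ring_scope.

Section Antiderivative.
Context (R : realType).
Implicit Types (f F : R -> R) (a x T : R).
Local Notation mu := (@lebesgue_measure R).

Lemma continuous_antiderivative f : continuous f ->
  exists F, forall x, is_derive x 1 F (f x).
Proof.
move=> cf.
have intf a x : mu.-integrable `[a, x]%classic (EFin \o f).
  apply: continuous_compact_integrable; first exact: segment_compact.
  exact: continuous_subspaceT.
pose G a x : R := \int[mu]_(t in `[a, x]%classic) f t.
have chasles a b x : a <= b -> b <= x -> G a x = G a b + G b x.
  move=> ab bx.
  have : G a x - G a b = \int[mu]_(t in `]b, x]%classic) f t.
    by apply: Rintegral_itvB; rewrite ?bnd_simp.
  (* The endpoint [b] has measure zero, so the half-open interval may be closed. *)
  rewrite Rintegral_itv_obnd_cbnd => [/eqP|].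
    by rewrite subr_eq addrC => /eqP.
  by apply: integrableS (intf b x) => //; exact: subset_itv_oc_cc.
(* This is the oriented integral of [f] from 0 to [x], for either sign of [x]. *)
pose F x := G (Num.min 0 x) x - G (Num.min 0 x) 0.
have FE a x : a <= 0 -> a <= x -> F x = G a x - G a 0.
  move=> a0 ax; have am : a <= Num.min 0 x by rewrite le_min a0.
  rewrite /F (chasles a (Num.min 0 x) x) ?ge_min ?lexx ?orbT//.
  rewrite (chasles a (Num.min 0 x) 0) ?ge_min ?lexx//.
  by rewrite opprD addrACA subrr add0r.
(* The base point lies strictly to the left of [x], so that the fundamental theorem applies at an
   interior point of [[a, x + 1]], and to the left of 0, so that [FE] identifies [F] with [G a] up
   to a constant near [x]. *)
exists F => x; pose a := Num.min 0 x - 1.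
have ax : a < x by rewrite /a ltrBlDr gt_min ltrDl ltr01 orbT.
have a0 : a <= 0 by rewrite /a lerBlDr ge_min add0r ler01.
have x1 : x < x + 1 by rewrite ltrDl.
have [dG G'] := continuous_FTC1_closed x1 (intf a (x + 1)) ax (cf x).
have dGx : is_derive x 1 (fun y => G a y - G a 0) (f x).
  rewrite -[f x]subr0; apply: is_deriveB.
  by apply: DeriveDef => //; rewrite -derive1E.
apply: near_eq_is_derive dGx.
near=> y; rewrite (FE a)//; apply: ltW.
by near: y; exact: lt_nbhsr.
Unshelve. all: by end_near. Qed.

Lemma periodic_antiderivative f T : T != 0 -> continuous f -> periodic f T ->
  exists c F, periodic F T /\ forall x, is_derive x 1 F (f x - c).
Proof.
move=> T0 cf pf; have [F dF] := continuous_antiderivative cf.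
(* The mean value of [f] over one period. *)
pose c := (F T - F 0) / T.
exists c, (fun x => F x - c * x); split=> [x|x]; last first.
  have d : is_derive x 1 (fun y : R => c * y) c.
    by rewrite -[X in is_derive _ _ _ X]mulr1; exact: is_deriveZ.
  exact: is_deriveB.
(* The increment of [F] over a period has derivative [f (y + T) - f y = 0], hence is constant. *)
have FT : F (x + T) - F x = F (0 + T) - F 0.
  apply: (@is_derive_0_is_cst _ (fun y => F (y + T) - F y)) => y.
  rewrite -(subrr (f y)); apply: is_deriveB.
  rewrite -[f y]mulr1 -pf.
  apply: (@is_derive1_comp _ F (fun z => z + T)).
  by rewrite -[X in is_derive _ _ _ X]addr0; exact: is_deriveD.
have cT : c * T = F T - F 0 by rewrite divfK.
rewrite add0r in FT.
by rewrite mulrDr cT -FT; ring.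
Qed.

End Antiderivative.

Section SmoothFunctions.
Context (R : realType).
Implicit Types (f F : R -> R) (x : R).

Lemma derive1_is_derive f F :
  (forall x, is_derive x 1 F (f x)) -> derive1 F = f.
Proof. by move=> dF; apply/funext => x; rewrite derive1E derive_val. Qed.

Lemma smooth_is_derive f F :
  (forall x, is_derive x 1 F (f x)) -> smooth f -> smooth F.
Proof.
move=> dF sf [|n] x; first exact: ex_derive.
by rewrite /derive1n iterSr (derive1_is_derive dF); exact: sf.
Qed.

Lemma is_derive_trig (a b x : R) :
  is_derive x 1 (fun y => a * sin y + b * cos y)
    (- b * sin x + a * cos x).
Proof.
rewrite addrC mulNr -mulrN; apply: is_deriveD; exact: is_deriveZ.
Qed.

(** Differentiation maps this family to itself, sending [(a, b)] to [(- b, a)]; hence the induction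
    with [a] and [b] general. *)
Lemma smooth_trig (a b : R) : smooth (fun x => a * sin x + b * cos x).
Proof.
move=> n; elim: n a b => [|n IHn] a b x.
  by apply: ex_derive; exact: is_derive_trig.
by rewrite /derive1n iterSr (derive1_is_derive (is_derive_trig a b)); exact: IHn.
Qed.

End SmoothFunctions.

Section FirstCohomology.
Context (R : realType).

Fact trig_is_vect (a b : R) :
  (fun x => a * sin x + b * cos x) \in @is_vect R.
Proof.
apply/asboolP; split; first exact: smooth_trig.
by move=> x; rewrite sinD2pi cosD2pi.
Qed.

Fact cst_is_vect (c : R) : cst c \in @is_vect R.
Proof. by apply/asboolP; split=> //; exact: smooth_cst. Qed.

Lemma Vect_perfect (w : Vect R) :
  exists u v s t : Vect R, w = bracket u v + bracket s t.
Proof.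
have T0 : pi *+ 2 != 0 :> R by rewrite lt0r_neq0 // pmulrn_lgt0 // pi_gt0.
have [c [F [pF dF]]] := periodic_antiderivative T0
  (smooth_continuous (@vect_smooth _ w)) (@vect_periodic _ w).
have sF : smooth F.
  apply: smooth_is_derive dF _; apply: (@smoothB _ w (cst c)).
    exact: vect_smooth.
  exact: smooth_cst.
have vF : F \in @is_vect R by exact/asboolP.
(* The bracket of 1 and [F] is [F' = w - c]. *)
exists (MkVect (cst_is_vect 1)), (MkVect vF).
(* These are [- c sin] and [cos], with bracket [c (sin^2 + cos^2) = c]. *)
exists (MkVect (trig_is_vect (- c) 0)), (MkVect (trig_is_vect 0 1)).
apply/val_inj/funext => x /=.
rewrite (derive1_is_derive dF) !(derive1_is_derive (is_derive_trig _ _)).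
rewrite -derive1n1 derive1n_cst !fctE/=.
ring: (cos2sin2 x).
Qed.

(** A family indexed by ['I_1] has a single slot, so [dfwith] replaces all of it. *)
Lemma multilinear1D (g : ('I_1 -> Vect R) -> R) (v w : Vect R) :
  multilinear g -> g (fun=> v + w) = g (fun=> v) + g (fun=> w).
Proof.
have E z : dfwith (fun=> 0) ord0 z = (fun=> z) :> ('I_1 -> Vect R).
  by apply/funext => i; rewrite (ord1 i); exact: dfwithin.
by move=> /(_ ord0 (fun=> 0) 1 v w); rewrite !E scale1r mul1r.
Qed.

Lemma cocycle1_eq0 (g : ('I_1 -> Vect R) -> R) :
  multilinear g -> coboundary g = 0 -> g = 0.
Proof.
move=> mg dg.
have g0 u v : g (fun=> bracket u v) = 0.
  (* On the pair [(u, v)] the coboundary of [g] is [- g [u, v]]. *)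
  pose z (i : 'I_2) := if i == ord0 then u else v.
  by apply/oppr_inj; rewrite oppr0 -(coboundary_1cochain g z) dg.
apply/funext => u; have [p [q [s [t upqst]]]] := Vect_perfect (u ord0).
have -> : u = fun=> bracket p q + bracket s t.
  by apply/funext => i; rewrite ord1.
by rewrite multilinear1D// !g0 addr0.
Qed.

End FirstCohomology.

Theorem propositionA2 (R : realType) : forall c : H_GF R 1, c = 0.
Proof.
elim/quotW => z.
have /asboolP[[[mz _] _] dz] := valP z.
(* The class of [z] is zero exactly when [z] is a coboundary; being the zero cochain, it is the
   coboundary of 0. *)
apply/eqP; rewrite -[0]pi_zeror -Quotient.idealrBE subr0; apply/asboolP.
exists 0; first exact: is_local_cochain0.
by rewrite coboundary0; exact: cocycle1_eq0.
Qed.
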